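(* Let $\mathcal{M}=(V,\mathcal{I})$ be a matroid of rank $k$ with weights $\omega:V\to\mathbb{R}^+$, let $t$ be a positive integer and $\tau$ a positive integer. Consider the following greedy procedure on $\tau\mathcal{M}=(V,\mathcal{I}_\tau)$: start with $V'=\emptyset$; process the elements of $V$ in non-increasing order of $\omega$; for each element $u$, add $u$ to $V'$ if $V'\cup\{u\}\in\mathcal{I}_\tau$, and otherwise ignore it. Then the final set $V'$ is $t$-robust (i) if $\mathcal{M}$ is a partition matroid and $\tau\ge t$; (ii) if $\mathcal{M}$ is a laminar matroid and $\tau\ge 2t$; (iii) if $\mathcal{M}$ is a transversal matroid and $\tau\ge t+k-1$.
   Context: $\tau\mathcal{M}=(V,\mathcal{I}_\tau)$ is the union of $\tau$ copies of $\mathcal{M}$: $S\in\mathcal{I}_\tau$ iff $S$ can be partitioned into $S_1\cup\dots\cup S_\tau$ with each $S_i\in\mathcal{I}$. A set $V'\subseteq V$ is $t$-robust (with respect to $\omega$) if for every base $O$ of $\mathcal{M}$, writing $O\setminus V'=\{u_1,\dots,u_r\}$, there are subsets $U_{u_1},\dots,U_{u_r}\subseteq V'\setminus O$ such that: (i) the $U_{u_i}$ are mutually disjoint and $|U_{u_i}|=t$; (ii) every element of $U_{u_i}$ has weight $\omega$ at least $\omega(u_i)$; (iii) for any choice of $u'_i\in U_{u_i}$ for each $i$, the set $(V'\cap O)\cup\{u'_1,\dots,u'_r\}$ is a base of $\mathcal{M}$. A partition matroid is given by a partition $V_1,\dots,V_r$ of $V$ and bounds $k_i$, with $S$ independent iff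 $|S\cap V_i|\le k_i$ for all $i$. A laminar matroid is given by a laminar family $V_1,\dots,V_r$ of subsets of $V$ (any two members are disjoint or one contains the other) and bounds $k_i$, with $S$ independent iff $|S\cap V_i|\le k_i$ for all $i$. A transversal matroid is given by a family $V_1,\dots,V_k\subseteq V$, with $S=\{u_1,\dots,u_s\}$ independent iff there are distinct indices $\phi(i)$ with $u_i\in V_{\phi(i)}$. *)

(* Defs.v *)
From mathcomp Require Import all_boot all_order all_algebra.
Import Order.TTheory GRing.Theory Num.Theory.

Set Implicit Arguments.
Unset Strict Implicit.
Unset Printing Implicit Defensive.

(* The ground set V of the matroid is the whole finite type T. *)
Record matroid (T : finType) := Matroid {
  indep : pred {set T};
  indep_set0 : indep set0;
  indep_subset : forall A B : {set T}, A \subset B -> indep B -> indep A;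
  indep_augment : forall A B : {set T}, indep A -> indep B -> #|A| < #|B| ->
    exists2 x, x \in B :\: A & indep (x |: A)
}.

Section Matroids.
Variable T : finType.
Implicit Types (M : matroid T) (S O : {set T}).

Definition base M O : bool := maxset (indep M) O.

Definition rank M : nat := \max_(S : {set T} | indep M S) #|S|.

(* Independence in the union of tau copies of M; parts may be empty. *)
Definition union_indep M (tau : nat) : pred {set T} := fun S =>
  [exists P : {ffun 'I_tau -> {set T}},
    [&& S == \bigcup_(i < tau) P i,
        [forall i, forall j, (i != j) ==> [disjoint P i & P j]] &
        [forall i, indep M (P i)]]].

Definition partition_matroid M : Prop :=
  exists (P : {set {set T}}) (b : {set T} -> nat),
    partition P [set: T] /\
    forall S, indep M S <-> (forall B, B \in P -> #|S :&: B| <= b B).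

Definition laminar (r : nat) (F : 'I_r -> {set T}) : Prop :=
  forall i j, [|| [disjoint F i & F j], F i \subset F j | F j \subset F i].

Definition laminar_matroid M : Prop :=
  exists (r : nat) (F : 'I_r -> {set T}) (b : 'I_r -> nat),
    laminar F /\
    forall S, indep M S <-> (forall i, #|S :&: F i| <= b i).

(* phi is only defined on S, so that set0 is independent even when m = 0.  The
   number m of sets in the presentation need not be the rank of M. *)
Definition transversal_matroid M : Prop :=
  exists (m : nat) (F : 'I_m -> {set T}),
    forall S, indep M S <->
      exists phi : {u : T | u \in S} -> 'I_m,
        injective phi /\ forall u, val u \in F (phi u).

(* The elements are examined in the order in which they occur in s. *)
Definition greedy (I : pred {set T}) (s : seq T) : {set T} :=
  foldl (fun V' u => if I (u |: V') then u |: V' else V') set0 s.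

Local Open Scope ring_scope.

(* Ties between equal weights may be broken in any way. *)
Definition nonincreasing_order (R : realFieldType) (w : T -> R) (s : seq T) :
    bool :=
  perm_eq s (enum T) && sorted (fun x y => w y <= w x) s.

(* The values of U and f outside O :\: V' are irrelevant. *)
Definition robust (R : realFieldType) M (w : T -> R) (t : nat)
    (V' : {set T}) : Prop :=
  forall O, base M O ->
  exists U : T -> {set T},
    [/\ {in O :\: V', forall u, U u \subset V' :\: O},
        {in O :\: V' &, forall u v, u != v -> [disjoint U u & U v]},
        {in O :\: V', forall u, #|U u| = t},
        {in O :\: V', forall u, {in U u, forall v, w u <= w v}} &
        forall f : T -> T, {in O :\: V', forall u, f u \in U u} ->
          base M ((V' :&: O) :|: [set f u | u in O :\: V'])].

End Matroids.

(* Main.v *)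
Require Import Defs.
From mathcomp Require Import all_boot all_order all_algebra.
From mathcomp Require Import zify.
Import Order.TTheory GRing.Theory Num.Theory.

(**
An element rejected by the greedy procedure is blocked by a tight constraint all
of whose slots are taken by earlier, hence at least as heavy, elements.

Partition: O has at most k_i elements in a full block V_i, where V' has tau k_i
elements, so disjoint t-subsets of V' \ O can be handed out inside each block.

Laminar: process the sets F i by increasing cardinality, starting from the
partition of V' into singletons.  Inside F i, merge any two pieces that avoid O
and have fewer than t elements, so that merged pieces have at most 2t - 2 <= tau
elements, then drop unassigned pieces until at most b i of them are left.
Counting tau for each big piece (one of size at least t, or an element of O) and
the cardinality for each small one, the pieces inside F i always account for
|V' :&: F i| elements; if F i is tight for u, there are therefore b i big pieces
inside F i, and since O has at most b i elements there, one is left for u.  At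
most b i pieces meet F i, so one element of each assigned piece gives an
independent set.

Transversal: fix an assignment psi of V' to the indices with fibers of size at
most tau and a matching phi of O.  Alternating paths show that if u is rejected
then the psi-fiber of phi u has tau elements, all examined before u; at most
k - 1 of them are in O, and any other one may replace u in the matching.
*)

Set Implicit Arguments.
Unset Strict Implicit.
Unset Printing Implicit Defensive.

(** * The greedy procedure *)

Section Greedy.
Variables (R : realFieldType) (T : finType) (I : pred {set T}) (w : T -> R).

Lemma greedy_rcons s v : greedy I (rcons s v) =
  if I (v |: greedy I s) then v |: greedy I s else greedy I s.
Proof. by rewrite /greedy -cats1 foldl_cat. Qed.

Lemma greedy_sub s : {subset greedy I s <= s}.
Proof.
elim/last_ind: s => [|s v IH] x; first by rewrite inE.
rewrite greedy_rcons mem_rcons inE.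
by case: ifP => _; rewrite ?inE; [case/orP=> [->//|/IH->]|move/IH->]; rewrite orbT.
Qed.

Lemma greedy_feasible s : I set0 -> I (greedy I s).
Proof.
by move=> I0; elim/last_ind: s => [|s v IH] //; rewrite greedy_rcons; case: ifP.
Qed.

(** The blocking set is what greedy holds at the moment [u] is examined: it survives into the output
    because greedy never discards, and its elements precede [u]. Giving it as a greedy output lets
    [greedy_feasible] apply to it. *)
Lemma greedy_rejected s u : sorted (fun x y => w y <= w x)%R s ->
  u \in s -> u \notin greedy I s ->
  exists S : {set T}, [/\ S = greedy I (take (index u s) s), S \subset greedy I s,
    ~~ I (u |: S) & {in S, forall x, (w u <= w x)%R}].
Proof.
have wtr : transitive (fun x y => w y <= w x)%R.
  by move=> y x z xy yz; apply: le_trans xy.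
rewrite sorted_pairwise //.
elim/last_ind: s => [|s v IH] //; rewrite pairwise_rcons => /andP[/allP sv ss].
rewrite mem_rcons inE greedy_rcons.
case: (boolP (u \in s)) => [us _ un|us]; last first.
  rewrite orbF => /eqP uv; move: us; rewrite uv => us.
  case: ifPn => [_|nI _]; first by rewrite !inE eqxx.
  exists (greedy I s); split=> //; last by move=> x /greedy_sub/sv.
  by rewrite -cats1 index_cat (negPf us) /= eqxx addn0 take_size_cat.
have sub : greedy I s \subset (if I (v |: greedy I s) then v |: greedy I s else greedy I s).
  by case: ifP => // _; apply: subsetUr.
have [|S [ES S1 S2 S3]] := IH ss us; first by apply: contraNN un; apply/subsetP.
exists S; split=> //; last by apply: subset_trans sub.
by rewrite -cats1 index_cat us takel_cat // index_size.
Qed.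
End Greedy.

(** * Bases, and reduction of robustness to an exchange property *)

Section Bases.
Variables (T : finType) (M : matroid T).

Lemma base_indep O : base M O -> indep M O.
Proof. exact: maxsetp. Qed.

Lemma base_card_max O S : base M O -> indep M S -> #|S| <= #|O|.
Proof.
move=> bO iS; rewrite leqNgt; apply/negP => lt.
have [x /setDP[_ xO] ixO] := indep_augment (base_indep bO) iS lt.
have /maxsetP[_ /(_ _ ixO (subsetUr _ _)) E] := bO.
by case/negP: xO; rewrite -E setU11.
Qed.

Lemma indep_base O S : base M O -> indep M S -> #|S| = #|O| -> base M S.
Proof.
move=> bO iS cS; apply/maxsetP; split=> // B iB SB.
by apply/esym/eqP; rewrite eqEcard SB cS base_card_max.
Qed.

Lemma base_card O : base M O -> #|O| = rank M.
Proof.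
move=> bO; apply/eqP; rewrite eqn_leq /rank; apply/andP; split.
  exact: (leq_bigmax_cond O (base_indep bO)).
by apply/bigmax_leqP => S; apply: base_card_max.
Qed.

End Bases.

Lemma subset_card_eq (T : finType) (n : nat) (A : {set T}) :
  n <= #|A| -> {B : {set T} | B \subset A & #|B| = n}.
Proof.
move=> nA; exists [set:: take n (enum A)].
  by apply/subsetP => x; rewrite inE => /mem_take; rewrite mem_enum.
rewrite cardsE; have /card_uniqP -> : uniq (take n (enum A)).
  by rewrite take_uniq // enum_uniq.
by rewrite size_takel // -cardE.
Qed.

(** Candidate sets may be larger than [t], since they can be truncated. Independence of the
    exchanged set suffices, since disjointness of the candidates makes the exchange injective and an
    independent set as large as a base is a base. The element [u0] provides default indices in the
    applications. *)
Lemma robust_of_exchange (R : realFieldType) (T : finType) (M : matroid T)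
    (w : T -> R) (t : nat) (V' : {set T}) :
  (forall O u0, base M O -> u0 \in O :\: V' -> exists A : T -> {set T},
    [/\ {in O :\: V', forall u, A u \subset V' :\: O},
        {in O :\: V' &, forall u v, u != v -> [disjoint A u & A v]},
        {in O :\: V', forall u, t <= #|A u|},
        {in O :\: V', forall u, {in A u, forall v, w u <= w v}%R} &
        forall g : T -> T, {in O :&: V', g =1 id} ->
          {in O :\: V', forall u, g u \in A u} -> indep M (g @: O)]) ->
  robust M w t V'.
Proof.
move=> H O bO; have [OV|[u0 u0O]] := set_0Vmem (O :\: V').
  exists (fun=> set0); split=> [u|u v|u|u|f _]; rewrite ?OV ?inE // imset0 setU0.
  by rewrite setIC (setIidPl _) // -setD_eq0 OV.
have [A [A1 A2 A3 A4 A5]] := H O u0 bO u0O.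
(* Truncation of [A u] to [t] elements; the value [set0] occurs only when [A u] is too small, hence
   never on [O :\: V']. *)
pose U u := if (t <= #|A u|) =P true is ReflectT h
            then s2val (subset_card_eq h) else set0.
have UA u : U u \subset A u.
  by rewrite /U; case: eqP => [h|_]; [case: subset_card_eq | apply: sub0set].
have UAP u x : x \in U u -> x \in A u by apply/subsetP.
have Udisj : {in O :\: V' &, forall u v, u != v -> [disjoint U u & U v]}.
  move=> u v uO vO uv; apply: disjointWl (UA u) _.
  by apply: disjointWr (UA v) _; apply: A2.
exists U; split=> //.
- by move=> u uO; apply: subset_trans (A1 u uO).
- by move=> u /A3 h; rewrite /U; case: eqP => // h'; case: subset_card_eq.
- by move=> u uO v /UAP; apply: A4.
(* Extending the choice by the identity on [V'] turns the exchanged set into the image of [O]. *)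
move=> f fU; pose g u := if u \in V' then u else f u.
have gf u : u \in O :\: V' -> g u = f u /\ f u \in V' :\: O.
  move=> uO; have /setDP[_ /negPf nV] := uO; split; first by rewrite /g nV.
  by apply: (subsetP (A1 u uO)); apply/UAP/fU.
have -> : V' :&: O :|: [set f u | u in O :\: V'] = g @: O.
  apply/setP=> x; rewrite !inE; apply/idP/imsetP.
    case/orP=> [/andP[xV xO]|/imsetP[u uO ->]]; first by exists x; rewrite // /g xV.
    by exists u; [case/setDP: uO | rewrite (gf u uO).1].
  case=> u uO ->; rewrite /g; case: ifP => uV; first by rewrite uV uO.
  by apply/orP; right; apply: imset_f; rewrite inE uV.
apply: (indep_base bO); first apply: A5.
- by move=> u; rewrite inE /g => /andP[_ ->].
- by move=> u uO; rewrite (gf u uO).1; apply/UAP/fU.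
apply: card_in_imset => u v uO vO.
have [uV|uV] := boolP (u \in V'); have [vV|vV] := boolP (v \in V').
- by rewrite /g uV vV.
- have vD : v \in O :\: V' by rewrite inE vV.
  by have [-> /setDP[_ nO]] := gf v vD; rewrite /g uV => E; case/negP: nO; rewrite -E.
- have uD : u \in O :\: V' by rewrite inE uV.
  by have [-> /setDP[_ nO]] := gf u uD; rewrite /g vV => E; case/negP: nO; rewrite E.
have uD : u \in O :\: V' by rewrite inE uV.
have vD : v \in O :\: V' by rewrite inE vV.
rewrite (gf u uD).1 (gf v vD).1 => E; apply/eqP; apply: contraT => uv.
have /disjointFr/(_ (fU u uD)) := Udisj _ _ uD vD uv.
by rewrite E fU.
Qed.

(** * Nested families and the union of copies *)

Definition nested (T : finType) (A B : {set T}) :=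
  [|| [disjoint A & B], A \subset B | B \subset A].

Section Nested.
Variables (T : finType) (I : finType) (F : I -> {set T}).
Hypothesis Fnested : forall i j, nested (F i) (F j).

Lemma nested_smaller i j : #|F j| <= #|F i| ->
  [disjoint F j & F i] \/ F j \subset F i.
Proof.
move=> le; case/or3P: (Fnested j i) => sub; [by left | by right | right].
by have /eqP -> : F i == F j by rewrite eqEcard sub.
Qed.

Lemma contiguous_filter (p : pred T) (s a l c : seq T) :
  s = a ++ l ++ c -> all p l -> exists a' c', filter p s = a' ++ l ++ c'.
Proof.
move=> -> /all_filterP E; exists (filter p a), (filter p c).
by rewrite !filter_cat E.
Qed.

(** Treat the sets by increasing cardinality, each time moving the elements of [F i] stably to the
    front. An earlier [F j] is contained in [F i] or disjoint from it, so its block falls entirely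
    into one of the two filtered lists and stays contiguous. *)
Lemma contiguous_order (S : {set T}) : exists s : seq T,
  [/\ uniq s, s =i S &
    forall i, exists a l c, s = a ++ l ++ c /\ l =i S :&: F i].
Proof.
pose r := sort (fun i j => #|F i| <= #|F j|) (enum I).
have : pairwise (fun i j => #|F i| <= #|F j|) r.
  rewrite -sorted_pairwise; last by move=> j i k; apply: leq_trans.
  by apply: sort_sorted => i j /=; exact: leq_total.
suff H q : pairwise (fun i j => #|F i| <= #|F j|) q -> exists s : seq T,
    [/\ uniq s, s =i S &
      forall i, i \in q -> exists a l c, s = a ++ l ++ c /\ l =i S :&: F i].
  case/H=> s [s1 s2 s3]; exists s; split=> // i.
  by apply: s3; rewrite mem_sort mem_enum.
elim/last_ind: q => [|q i IH] in {r} *.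
  by exists (enum S); split=> //; [apply: enum_uniq | move=> x; rewrite mem_enum].
rewrite pairwise_rcons => /andP[/allP qi /IH[s [us Ss H]]].
exists (filter (mem (F i)) s ++ filter (predC (mem (F i))) s); split.
- by rewrite (perm_uniq (permEl (perm_filterC _ _))).
- by move=> x; rewrite (perm_mem (permEl (perm_filterC _ _))) Ss.
move=> j; rewrite mem_rcons inE => /orP[/eqP->|jq].
  exists [::], (filter (mem (F i)) s), (filter (predC (mem (F i))) s); split=> //.
  by move=> x; rewrite mem_filter in_setI Ss andbC.
have [a [l [c [E El]]]] := H j jq.
have [dj|sj] := nested_smaller (qi j jq).
  have [|a' [c' ->]] := contiguous_filter (p := predC (mem (F i))) E.
    apply/allP => x; rewrite El inE /= => /andP[_ xj].
    by rewrite (disjointFr dj xj).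
  by exists (filter (mem (F i)) s ++ a'), l, c'; rewrite -catA.
have [|a' [c' ->]] := contiguous_filter (p := mem (F i)) E.
  by apply/allP => x; rewrite El inE => /andP[_ /(subsetP sj)].
by exists a', l, (c' ++ filter (predC (mem (F i))) s); rewrite -!catA.
Qed.

(* Number S so that every F i is contiguous and use the positions modulo tau as colours. *)
Lemma nested_equitable_coloring (tau : nat) (b : I -> nat) (S : {set T}) :
  0 < tau -> (forall i, #|S :&: F i| <= tau * b i) ->
  exists P : {ffun 'I_tau -> {set T}},
    [/\ S = \bigcup_(c < tau) P c,
        forall c d, c != d -> [disjoint P c & P d] &
        forall c i, #|P c :&: F i| <= b i].
Proof.
move=> tau0 Sb; have [s [us Ss H]] := contiguous_order S.
exists [ffun c : 'I_tau => [set x in S | index x s %% tau == c]]; split.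
- apply/setP=> x; apply/idP/bigcupP => [xS|[c _]]; last by rewrite ffunE inE => /andP[].
  by exists (Ordinal (ltn_pmod (index x s) tau0)); rewrite // ffunE inE xS /=.
- move=> c d; rewrite !ffunE => cd; rewrite -setI_eq0; apply/eqP/setP => x.
  rewrite !inE; apply/negP => /andP[/andP[_ /eqP E1] /andP[_ /eqP E2]].
  by case/eqP: cd; apply: val_inj; rewrite /= -E1 -E2.
move=> c i; rewrite ffunE; have [a [l [e [E El]]]] := H i.
set Q := _ :&: _.
have ul : uniq l by move: us; rewrite E !cat_uniq => /and3P[_ _ /and3P[]].
have Ql x : x \in Q -> x \in l by rewrite El !inE => /andP[/andP[-> _] ->].
have Qi x : x \in Q -> (size a + index x l) %% tau = c.
  move=> xQ; have xl := Ql x xQ; move: xQ; rewrite !inE => /andP[/andP[_ /eqP <-] _].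
  rewrite E index_cat index_cat xl ifN //.
  by move: us; rewrite E cat_uniq => /and3P[_ /hasPn h _]; apply: h; rewrite mem_cat xl.
have sl : size l <= tau * b i.
  by have /card_uniqP <- := ul; rewrite (eq_card El).
(* Within one colour the residue modulo [tau] is fixed, so the quotients determine the positions in
   [l]; as [l] has at most [tau * b i] elements, they are below [b i]. *)
rewrite cardE -(size_map (fun x => index x l %/ tau)) -(size_iota 0 (b i)).
apply: uniq_leq_size.
  rewrite map_inj_in_uniq ?enum_uniq // => x y; rewrite !mem_enum => xQ yQ Exy.
  have Em : index x l == index y l %[mod tau].
    by rewrite -(eqn_modDl (size a)) !Qi.
  have Ei : index x l = index y l.
    by rewrite (divn_eq (index x l) tau) (divn_eq (index y l) tau) Exy (eqP Em).
  by rewrite -(nth_index x (Ql x xQ)) Ei nth_index // Ql.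
move=> n /mapP[x]; rewrite mem_enum => /Ql xl ->.
by rewrite mem_iota /= add0n ltn_divLR // mulnC (leq_trans _ sl) // index_mem.
Qed.

(** Summing the bounds over the copies gives one direction; for the other, the colour classes of an
    equitable colouring serve as the independent parts. *)
Lemma nested_union_indep (M : matroid T) (b : I -> nat) (tau : nat) (S : {set T}) :
  0 < tau -> (forall A, indep M A <-> forall i, #|A :&: F i| <= b i) ->
  union_indep M tau S <-> forall i, #|S :&: F i| <= tau * b i.
Proof.
move=> tau0 HM; split.
  case/existsP=> P /and3P[/eqP -> _ /forallP iP] i.
  apply: (@leq_trans (\sum_(c < tau) #|P c :&: F i|)).
    elim/big_rec2: _ => [|c m A _ IH]; first by rewrite set0I cards0.
    by rewrite setIUl (leq_trans (leq_card_setU _ _)) // leq_add2l.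
  rewrite -[tau in _ <= tau * _]card_ord -sum_nat_const.
  by apply: leq_sum => c _; apply: (HM (P c)).1.
move=> /(nested_equitable_coloring tau0)[P [-> Pd Pb]].
apply/existsP; exists P; apply/and3P; split=> //.
  by apply/forallP=> c; apply/forallP=> d; apply/implyP; apply: Pd.
by apply/forallP=> c; apply/HM.
Qed.

End Nested.

(** * Tight sets created by the greedy procedure *)

Section GreedyNested.
Variables (R : realFieldType) (T : finType) (w : T -> R) (M : matroid T).
Variables (tau : nat) (s : seq T).
Hypotheses (tau_gt0 : 0 < tau) (hs : nonincreasing_order w s).

Lemma union_indep0 : union_indep M tau set0.
Proof.
apply/existsP; exists [ffun=> set0]; apply/and3P; split.
- by rewrite big1 // => i _; rewrite ffunE.
- by apply/forallP => i; apply/forallP => j; rewrite !ffunE -setI_eq0 set0I eqxx implybT.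
- by apply/forallP => i; rewrite ffunE indep_set0.
Qed.

Lemma greedy_union_feasible : union_indep M tau (greedy (union_indep M tau) s).
Proof. exact/greedy_feasible/union_indep0. Qed.

Lemma greedy_union_rejected u : u \notin greedy (union_indep M tau) s ->
  exists S : {set T}, [/\ union_indep M tau S, S \subset greedy (union_indep M tau) s,
    ~~ union_indep M tau (u |: S) & {in S, forall x, (w u <= w x)%R}].
Proof.
case/andP: hs => ps ss un.
have us : u \in s by rewrite (perm_mem ps) mem_enum.
have [S [ES S1 S2 S3]] := greedy_rejected ss us un.
by exists S; split=> //; rewrite ES; apply/greedy_feasible/union_indep0.
Qed.

Variables (I : finType) (F : I -> {set T}) (b : I -> nat).
Hypothesis Fnested : forall i j, nested (F i) (F j).
Hypothesis HM : forall A, indep M A <-> forall i, #|A :&: F i| <= b i.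

Let V' := greedy (union_indep M tau) s.

Lemma greedy_nested_card i : #|V' :&: F i| <= tau * b i.
Proof. exact: (nested_union_indep Fnested _ tau_gt0 HM).1 greedy_union_feasible i. Qed.

(** Some bound is already saturated when [u] is examined. The final [V'] obeys the same bound, so
    nothing enters [F i] later and all of [V' :&: F i] was examined before [u]. *)
Lemma greedy_nested_tight u : u \notin V' -> exists i,
  [/\ u \in F i, tau * b i <= #|V' :&: F i| &
      {in V' :&: F i, forall x, (w u <= w x)%R}].
Proof.
move=> uV; have [S [iS SV nS Sw]] := greedy_union_rejected uV.
have {nS} [i ti] : exists i, tau * b i < #|(u |: S) :&: F i|.
  apply/existsP; apply: contraNT nS => /existsPn nS.
  by apply/(nested_union_indep Fnested _ tau_gt0 HM) => i; rewrite leqNgt nS.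
have Si := (nested_union_indep Fnested _ tau_gt0 HM).1 iS i.
have ui : u \in F i.
  apply: contraLR ti => ui; rewrite -leqNgt; apply: leq_trans Si.
  by rewrite setIUl (_ : [set u] :&: F i = set0) ?set0U //; apply/disjoint_setI0; rewrite disjoints1.
have tS : tau * b i <= #|S :&: F i|.
  move: ti; rewrite setIUl (setIidPl _) ?sub1set // => ti.
  by rewrite -ltnS (leq_trans ti) // cardsU1; case: (u \in _) => //=; rewrite add0n.
have SE : S :&: F i = V' :&: F i.
  apply/eqP; rewrite eqEcard setSI //= (leq_trans _ tS) //.
  exact: greedy_nested_card.
by exists i; split; rewrite -?SE // => x /setIP[xS _]; apply: Sw.
Qed.

End GreedyNested.

(** * Clusters in laminar families *)

(** Cut an enumeration of each [X (key u)] into consecutive runs of length [t], and give the run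
    numbered [c] to the element of rank [c] among those sharing the key. *)
Lemma disjoint_blocks (T : finType) (K : eqType) (D : {set T}) (key : T -> K)
    (X : K -> {set T}) (t : nat) : 0 < t ->
  {in D &, forall u v, key u != key v -> [disjoint X (key u) & X (key v)]} ->
  {in D, forall u, t * #|[set v in D | key v == key u]| <= #|X (key u)|} ->
  exists A : T -> {set T},
    [/\ {in D, forall u, A u \subset X (key u)},
        {in D &, forall u v, u != v -> [disjoint A u & A v]} &
        {in D, forall u, t <= #|A u|}].
Proof.
move=> t0 Xd Xt.
pose c u := index u (enum [set v in D | key v == key u]).
pose A u := [set x in X (key u) | index x (enum (X (key u))) %/ t == c u].
have AX u : A u \subset X (key u) by apply/subsetP => x; rewrite inE => /andP[].
exists A; split=> [u _|u v uD vD uv|u uD]; first exact: AX.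
  have [E|/(Xd _ _ uD vD) d] := eqVneq (key u) (key v); last first.
    exact: disjointW (AX u) (AX v) d.
  rewrite -setI_eq0; apply/eqP/setP => x; rewrite !inE E; apply/negP.
  case/andP=> /andP[_ /eqP ->] /andP[_ /eqP]; rewrite /c E => Ei.
  have ue : u \in enum [set v0 in D | key v0 == key v] by rewrite mem_enum inE uD E /=.
  have ve : v \in enum [set v0 in D | key v0 == key v] by rewrite mem_enum inE vD /=.
  by case/eqP: uv; rewrite -(nth_index u ue) Ei nth_index.
have cu : c u < #|[set v in D | key v == key u]|.
  by rewrite cardE index_mem mem_enum inE uD /=.
have lt i : i < t -> c u * t + i < #|X (key u)|.
  by move=> it; apply: leq_trans (Xt u uD); nia.
pose h (i : 'I_t) := nth u (enum (X (key u))) (c u * t + i).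
have hinj : injective h.
  move=> i j; rewrite /h => /eqP; rewrite nth_uniq ?enum_uniq -?cardE ?lt //.
  by rewrite eqn_add2l => /eqP/val_inj.
rewrite -[t in t <= _]card_ord -(card_imset predT hinj).
apply/subset_leq_card/subsetP => _ /imsetP[i _ ->].
rewrite inE -mem_enum mem_nth -?cardE ?lt //=.
by rewrite index_uniq ?enum_uniq -?cardE ?lt // divnMDl // divn_small // addn0.
Qed.

Lemma card_injection (T U : finType) (x0 : U) (E : {set T}) (G : {set U}) :
  #|E| <= #|G| ->
  exists f : T -> U, {in E &, injective f} /\ {in E, forall u, f u \in G}.
Proof.
move=> EG; exists (fun u => nth x0 (enum G) (index u (enum E))).
have lt u : u \in E -> index u (enum E) < size (enum G).
  by move=> uE; rewrite -cardE (leq_trans _ EG) // cardE index_mem mem_enum.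
split=> [u v uE vE /eqP|u uE]; last by rewrite -mem_enum mem_nth ?lt.
rewrite nth_uniq ?enum_uniq ?lt // => /eqP Ei.
by rewrite -(nth_index u (_ : u \in enum E)) ?mem_enum // Ei nth_index // mem_enum.
Qed.

Section Clusters.
Variables (T I : finType) (F : I -> {set T}) (b : I -> nat) (t tau : nat).
Variables (V' O : {set T}) (beta : T -> I).
Hypothesis Fnested : forall i j, nested (F i) (F j).
Hypotheses (t_gt0 : 0 < t) (t_tau : 2 * t <= tau).
Hypothesis OF : forall i, #|O :&: F i| <= b i.
Hypothesis VF : forall i, #|V' :&: F i| <= tau * b i.
Hypothesis betaF : {in O :\: V', forall u, u \in F (beta u)}.
Hypothesis betaV : {in O :\: V', forall u, tau * b (beta u) <= #|V' :&: F (beta u)|}.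

Implicit Types (K L : {set {set T}}) (p W X : {set T}) (q : seq I).

(** Small pieces are those that cannot serve any element of [O] yet and may still be merged. *)
Definition small p := (#|p| < t) && [disjoint p & O].
(** Crediting a big piece with [tau] whatever its size makes the total credit inside [F i] survive
    merging, and lets a saturated bound be read as a lower bound on the number of big pieces. *)
Definition cost p := if small p then #|p| else tau.
Definition inside K X := [set p in K | p \subset X].
Definition meeting K X := [set p in K | ~~ [disjoint p & X]].

(** The indices [q1] are those inside whose sets merging has been allowed, [q2] those whose bound is
    already enforced. While [F i] is being treated they differ exactly by [i]. *)
Definition pieces q1 q2 K := [/\ {in K &, forall p r, p != r -> [disjoint p & r]},
  set0 \notin K, {in K, forall p, p \subset V'},
  {in K, forall p, (exists x, p = [set x]) \/
                   [disjoint p & O] /\ exists2 j, j \in q1 & p \subset F j} &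
  {in q2, forall j, #|meeting K (F j)| <= b j}].

(** Invariant while [F i] is being treated, with [K0] the collection at the start. The last clause
    lets counts outside [F i] carry over from [K0]. *)
Definition reduced q i K0 K := [/\ pieces (rcons q i) q K,
  {in K, forall p, p \subset F i \/ [disjoint p & F i]},
  #|V' :&: F i| <= \sum_(p in inside K (F i)) cost p &
  forall p, ~~ (p \subset F i) -> (p \in K) = (p \in K0)].

Lemma cost_le_tau p : cost p <= tau.
Proof. by rewrite /cost /small; case: ifP => // /andP[h _]; lia. Qed.

Lemma sum_cost_le K : \sum_(p in K) cost p <= #|K| * tau.
Proof. by rewrite -sum_nat_const; apply: leq_sum => p _; apply: cost_le_tau. Qed.

Lemma sum_cost_big K : {in K, forall p, ~~ small p} -> \sum_(p in K) cost p = #|K| * tau.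
Proof.
move=> nK; rewrite -sum_nat_const; apply: eq_bigr => p /nK.
by rewrite /cost => /negPf ->.
Qed.

Lemma reduced_merge q i K0 K p r : reduced q i K0 K ->
  p \in inside K (F i) -> r \in inside K (F i) -> p != r -> small p -> small r ->
  let K' := (p :|: r) |: (K :\ p :\ r) in
  reduced q i K0 K' /\ #|K'| < #|K|.
Proof.
move=> [[K1 K2 K3 K4 K5] KF KV KK0]; rewrite !inE => /andP[pK pF] /andP[rK rF] pr sp sr K'.
have dpr := K1 _ _ pK rK pr.
have [/andP[pt pO] /andP[rt rO]] := (sp, sr).
have pN0 : p != set0 by apply: contraNneq K2 => <-.
have rN0 : r != set0 by apply: contraNneq K2 => <-.
have prF : p :|: r \subset F i by rewrite subUset pF.
have prO : [disjoint p :|: r & O].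
  by rewrite -setI_eq0 setIUl setU_eq0 !setI_eq0 pO rO.
have prK' : p :|: r \notin K :\ p :\ r.
  rewrite !inE; apply/negP => /and3P[n1 n2 prK].
  have := K1 _ _ prK pK n2; rewrite -setI_eq0 setUK.
  by rewrite (negPf pN0).
have inK' z : z \in K' -> z = p :|: r \/ [/\ z \in K, z != p & z != r].
  by rewrite !inE => /orP[/eqP|/and3P[]]; [left | right].
have djpr z : z \in K -> z != p -> z != r -> [disjoint z & p :|: r].
  move=> zK zp zr; rewrite -setI_eq0 setIUr setU_eq0 !setI_eq0.
  by rewrite !K1.
have cK : #|K'| < #|K|.
  rewrite cardsU1 prK' (cardsD1 p K) pK (cardsD1 r (K :\ p)) !inE eq_sym pr rK.
  by rewrite !add1n.
split=> //; split; [split| | |].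
- move=> x y /inK'[->|[xK xp xr]] /inK'[->|[yK yp yr]] xy.
  + by rewrite eqxx in xy.
  + by rewrite disjoint_sym djpr.
  + by rewrite djpr.
  + by rewrite K1.
- apply/negP => /inK'[/esym/eqP|[]]; first by rewrite setU_eq0 (negPf pN0).
  by rewrite (negPf K2).
- by move=> z /inK'[->|[/K3]] //; rewrite subUset !K3.
- move=> z /inK'[->|[/K4]] //; right; split=> //.
  by exists i; rewrite // mem_rcons mem_head.
- move=> j jq; apply: leq_trans (K5 j jq).
  (* The new pieces meeting [F j] are images under [m] of old ones, since the union meets [F j] only
     if [p] or [r] does. *)
  pose m z := if (z == p) || (z == r) then p :|: r else z.
  apply: leq_trans (leq_imset_card m _); apply/subset_leq_card/subsetP => z.
  rewrite inE => /andP[/inK'[->|[zK zp zr]] zj].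
    have : ~~ [disjoint p & F j] || ~~ [disjoint r & F j].
      by rewrite -negb_and -!setI_eq0 -setU_eq0 -setIUl setI_eq0.
    case/orP=> h; apply/imsetP; [exists p | exists r]; rewrite ?inE ?pK ?rK //.
      by rewrite /m eqxx.
    by rewrite /m eqxx orbT.
  by apply/imsetP; exists z; rewrite ?inE ?zK // /m (negPf zp) (negPf zr).
- by move=> z /inK'[->|[/KF]] //; left.
- apply: leq_trans KV _.
  have -> : inside K' (F i) = (p :|: r) |: (inside K (F i) :\ p :\ r).
    apply/setP => z; rewrite !inE andb_orl -!andbA; congr orb.
    by case: eqP => // ->; rewrite prF.
  rewrite big_setU1; last by apply: contra prK'; rewrite !inE => /and4P[-> -> ->].
  rewrite (big_setD1 p) ?inE ?pK //= (big_setD1 r) /=; last by rewrite !inE eq_sym pr rK.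
  (* If the union is still small its cost is the sum of the two; otherwise its cost [tau] is at
     least [2 * t], which exceeds that sum. *)
  rewrite addnA leq_add2r {1 2}/cost sp sr /cost cardsU (disjoint_setI0 dpr) cards0 subn0.
  case: ifP => // _; apply: leq_trans t_tau; rewrite mul2n -addnn.
  exact/leq_add/ltnW/rt/ltnW/pt.
- move=> z zF; rewrite -KK0 // !inE.
  have -> : (z == p :|: r) = false by apply: contraNF zF => /eqP ->.
  have -> : z != r by apply: contraNneq zF => ->.
  by have -> : z != p by apply: contraNneq zF => ->.
Qed.

(** At least [b i] pieces remain inside [F i], all big, and they alone pay [tau * b i], which bounds
    [V' :&: F i]. *)
Lemma reduced_drop q i K0 K p : reduced q i K0 K ->
  p \in inside K (F i) -> b i < #|inside K (F i)| ->
  {in inside K (F i), forall r, r != p -> ~~ small r} ->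
  reduced q i K0 (K :\ p) /\ #|K :\ p| < #|K|.
Proof.
move=> [[K1 K2 K3 K4 K5] KF KV KK0] pI lt big.
have /andP[pK pF] : (p \in K) && (p \subset F i) by rewrite inE in pI.
have sub z : z \in K :\ p -> z \in K by rewrite inE => /andP[].
split; last by rewrite (cardsD1 p K) pK.
split; [split| | |].
- by move=> x y /sub xK /sub; apply: K1.
- by rewrite inE (negPf K2) andbF.
- by move=> x /sub; apply: K3.
- by move=> x /sub; apply: K4.
- move=> j /K5; apply: leq_trans; apply/subset_leq_card/subsetP => z.
  by rewrite !inE => /andP[/andP[_ ->] ->].
- by move=> x /sub; apply: KF.
- have -> : inside (K :\ p) (F i) = inside K (F i) :\ p.
    by apply/setP => z; rewrite !inE andbA.
  rewrite sum_cost_big; last by move=> z; rewrite in_setD1 => /andP[zp zI]; apply: big.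
  apply: leq_trans (VF i) _; rewrite mulnC leq_mul2r; apply/orP; right.
  by move: lt; rewrite (cardsD1 p (inside K _)) pI.
- move=> z zF; rewrite -KK0 // !inE.
  by have -> : z != p by apply: contraNneq zF => ->.
Qed.

(** Merge pairs of small pieces, then drop surplus ones; each move shrinks [K]. The protected pieces
    [L] are big, so merging leaves them intact, and they never need to be dropped. *)
Lemma reduction q i K0 K L : reduced q i K0 K -> L \subset K ->
  {in L, forall p, ~~ small p} -> #|inside L (F i)| <= b i ->
  exists K', [/\ reduced q i K0 K', L \subset K', #|inside K' (F i)| <= b i &
    {in inside K' (F i) &, forall p r, small p -> small r -> p = r}].
Proof.
have [n] := ubnP #|K|; elim: n => // n IH in K * => ltn red LK Lbig Lb.
have [/existsP[p /existsP[r /and5P[pI rI pr sp sr]]]|nms] := boolP [exists p, exists r,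
    [&& p \in inside K (F i), r \in inside K (F i), p != r, small p & small r]].
  have [red' lt] := reduced_merge red pI rI pr sp sr.
  apply: (IH _ _ red' _ Lbig Lb); first exact: leq_trans lt ltn.
  apply/subsetP => z zL; rewrite !inE (subsetP LK _ zL) andbT.
  have -> : z != r by apply: contraTneq sr => <-; apply: Lbig.
  have -> : z != p by apply: contraTneq sp => <-; apply: Lbig.
  by rewrite orbT.
have one : {in inside K (F i) &, forall p r, small p -> small r -> p = r}.
  move=> p r pI rI sp sr; apply/eqP; apply: contraNT nms => pr.
  by apply/existsP; exists p; apply/existsP; exists r; apply/and5P.
have [le|lt] := leqP #|inside K (F i)| (b i); first by exists K.
have drop p : p \in inside K (F i) -> p \notin L ->
    {in inside K (F i), forall r, r != p -> ~~ small r} ->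
    exists K', [/\ reduced q i K0 K', L \subset K', #|inside K' (F i)| <= b i &
      {in inside K' (F i) &, forall p r, small p -> small r -> p = r}].
  move=> pI pL big; have [red' lt'] := reduced_drop red pI lt big.
  apply: (IH _ _ red' _ Lbig Lb); first exact: leq_trans lt' ltn.
  by rewrite subsetD1 LK.
(* The unique small piece, if any, goes first, so that all others are big as dropping requires. If
   there is none, [Lb] leaves a piece outside [L] to drop. *)
have [/existsP[p /andP[pI sp]]|ns] := boolP [exists p, (p \in inside K (F i)) && small p].
  apply: (drop p) => //; first by apply: contraTN sp; apply: Lbig.
  by move=> r rI; apply: contraNN => sr; rewrite (one r p).
have [p /setDP[pI pL]] : exists p, p \in inside K (F i) :\: inside L (F i).
  apply/set0Pn; rewrite -card_gt0 cardsD subn_gt0 (leq_ltn_trans _ lt) //.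
  by apply: leq_trans Lb; apply/subset_leq_card/subsetIr.
apply: (drop p) => //.
  by apply: contraNN pL => pL; move: pI; rewrite !inE pL => /andP[].
move=> r rI _; apply: contraNN ns => sr.
by apply/existsP; exists r; rewrite rI.
Qed.

(** The set [X] ranges over all sets that cut no processed [F j], so that the bound applies both to
    the next [F i] and to differences [X :\: F i]. *)
Definition covers q K := forall X : {set T},
  {in q, forall j, F j \subset X \/ [disjoint F j & X]} ->
  #|V' :&: X| <= \sum_(p in inside K X) cost p.

(** An element of [O :&: V'] owns its singleton from the start; any other element of [O] receives a
    piece when its tight set [F (beta u)] is processed. *)
Definition assigned q := [set u in O | (u \in V') || (beta u \in q)].

Definition assignment q K (A : T -> {set T}) :=
  [/\ {in assigned q, forall u, A u \in K}, {in assigned q &, injective A},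
      {in O :&: V', forall u, A u = [set u]} &
      {in assigned q :\: V', forall u,
         [/\ A u \subset F (beta u), [disjoint A u & O] & t <= #|A u|]}].

Definition stage q := exists K A, [/\ pieces q q K, covers q K & assignment q K A].

Lemma stage0 : stage [::].
Proof.
exists [set [set x] | x in V'], set1; split; [split| |split] => //.
- move=> _ _ /imsetP[x _ ->] /imsetP[y _ ->] xy.
  by rewrite disjoints1 inE; apply: contraNN xy => /eqP ->.
- by apply/negP => /imsetP[x _ /esym/eqP]; rewrite -cards_eq0 cards1.
- by move=> _ /imsetP[x xV ->]; rewrite sub1set.
- by move=> _ /imsetP[x _ ->]; left; exists x.
- move=> X _; have -> : inside [set [set x] | x in V'] X = [set [set x] | x in V' :&: X].
    apply/setP => p; rewrite inE; apply/andP/imsetP => [[/imsetP[x xV ->]]|[x]].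
      by rewrite sub1set => xX; exists x; rewrite ?inE ?xV.
    by rewrite inE => /andP[xV xX] ->; rewrite sub1set imset_f.
  rewrite -(card_imset _ set1_inj) -sum1_card; apply: leq_sum => _ /imsetP[x _ ->].
  by rewrite /cost cards1; case: ifP => // _; lia.
- move=> u; rewrite !inE orbF => /andP[_ uV]; exact: imset_f.
- by move=> u v _ _; apply: set1_inj.
- by move=> u; rewrite !inE orbF => /and3P[/negPf ->].
Qed.

(** By the ordering, every current piece lies inside [F i] or misses it, so [reduction] applies. If
    [F i] is tight for some element, the cost count then leaves enough big unassigned pieces for all
    elements whose tight set is [F i]. *)
Lemma stage_rcons q i : i \notin q -> {in q, forall j, #|F j| <= #|F i|} ->
  stage q -> stage (rcons q i).
Proof.
move=> iq qi [K0 [A [[K1 K2 K3 K4 K5] Kcov [A1 A2 A3 A4]]]].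
have KF : {in K0, forall p, p \subset F i \/ [disjoint p & F i]}.
  move=> p /K4[[x ->]|[_ [j jq pj]]].
    by rewrite sub1set disjoints1; case: (x \in F i); [left|right].
  have [d|s] := nested_smaller Fnested (qi j jq); last by left; apply: subset_trans s.
  by right; apply: disjointWl d.
have Anz u : u \in assigned q -> A u != set0.
  by move=> uD; apply: contraNneq K2 => <-; apply: A1.
(* For [u] outside [V'], the smaller set [F (beta u)] contains the nonempty [A u], so it meets [F i]
   and hence lies inside it. *)
have AF u : u \in assigned q -> A u \subset F i -> u \in F i.
  move=> uD uF; have [uV|uV] := boolP (u \in V').
    have uO : u \in O :&: V' by move: uD; rewrite !inE uV => /andP[->].
    by move: uF; rewrite A3 // sub1set.
  have uDV : u \in assigned q :\: V' by rewrite inE uV.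
  have [ub _ _] := A4 u uDV.
  have uOV : u \in O :\: V' by move: uD; rewrite !inE uV => /andP[->].
  have bq : beta u \in q by move: uD; rewrite inE (negPf uV) => /andP[].
  have [d|s] := nested_smaller Fnested (qi _ bq); last exact: (subsetP s) (betaF uOV).
  have /set0Pn[x xA] := Anz u uD.
  by have := disjointFr d (subsetP ub x xA); rewrite (subsetP uF).
pose L := A @: assigned q; pose D := [set u in assigned q | A u \subset F i].
have LD : inside L (F i) = A @: D.
  apply/setP => p; rewrite inE; apply/andP/imsetP => [[/imsetP[u uD ->] uF]|[u]].
    by exists u; rewrite // in_set uD uF.
  by rewrite in_set => /andP[uD uF] ->; rewrite imset_f.
have cLD : #|inside L (F i)| = #|D|.
  rewrite LD; apply: card_in_imset => u v; rewrite !inE => /andP[uD _] /andP[vD _].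
  by apply: A2; rewrite inE.
pose E := [set u in O :\: V' | beta u == i].
(* Owners of pieces inside [F i] and elements now to be served are disjoint parts of [O :&: F i],
   because [i] is not in [q]. *)
have DE : #|D| + #|E| <= b i.
  apply: leq_trans (OF i); rewrite -cardsUI.
  have -> : D :&: E = set0.
    apply/setP => u; rewrite !inE; apply/negP => /andP[/andP[/andP[_ uD] _] /andP[/andP[uV _] /eqP ub]].
    by move: uD; rewrite (negPf uV) ub (negPf iq).
  rewrite cards0 addn0; apply/subset_leq_card/subsetP => u.
  rewrite inE => /orP[uD|uE].
    have /andP[uq uF] : (u \in assigned q) && (A u \subset F i) by rewrite inE in uD.
    by rewrite inE AF // andbT; move: uq; rewrite inE => /andP[].
  have /andP[uO /eqP ub] : (u \in O :\: V') && (beta u == i) by rewrite inE in uE.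
  by rewrite inE -ub betaF //; move: uO; rewrite inE => /andP[_ ->].
have red0 : reduced q i K0 K0.
  split=> //; last first.
    apply: Kcov => j jq; have [d|s] := nested_smaller Fnested (qi j jq); by [right|left].
  split=> // p /K4[?|[pO [j jq pj]]]; first by left.
  by right; split=> //; exists j; rewrite // mem_rcons inE jq orbT.
have LK0 : L \subset K0 by apply/subsetP => _ /imsetP[u uD ->]; apply: A1.
have Lbig : {in L, forall p, ~~ small p}.
  move=> _ /imsetP[u uD ->]; rewrite /small negb_and -leqNgt.
  have [uV|uV] := boolP (u \in V').
    have uO : u \in O by move: uD; rewrite inE => /andP[].
    by rewrite A3 ?inE ?uO // disjoints1 uO orbT.
  by have [|_ _ ->] := A4 u; rewrite // inE uV.
have [|K [red LK Kb Kone]] := reduction red0 LK0 Lbig _.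
  by rewrite cLD (leq_trans _ DE) // leq_addr.
case: red => -[J1 J2 J3 J4 J5] JF JV JK0.
have noinside (K' : {set {set T}}) p X : set0 \notin K' -> p \in K' ->
    p \subset X -> [disjoint X & F i] -> ~~ (p \subset F i).
  move=> K'0 pK pX d; apply: contraNN K'0 => pF; suff <- : p = set0 by [].
  by apply/eqP; rewrite -subset0 -(disjoint_setI0 d) subsetI pX.
have covd (X : {set T}) : {in q, forall j, F j \subset X \/ [disjoint F j & X]} ->
    [disjoint X & F i] -> #|V' :&: X| <= \sum_(p in inside K X) cost p.
  move=> Xq d; suff -> : inside K X = inside K0 X by apply: Kcov.
  apply/setP => p; rewrite !inE; apply/andP/andP => -[pK pX]; split=> //.
    by rewrite -JK0 // (noinside K p X).
  by rewrite JK0 // (noinside K0 p X).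
have tight u : u \in E -> tau * b i <= \sum_(p in inside K (F i)) cost p.
  by rewrite inE => /andP[uO /eqP ub]; apply: leq_trans JV; rewrite -ub betaV.
(* A small piece costs less than [t <= tau] and at most [b i - 1] others cost [tau] each, which
   falls short of [tau * b i]. *)
have ns u : u \in E -> {in inside K (F i), forall p, ~~ small p}.
  move=> /tight le p pI; apply/negP => sp; move: le; rewrite leqNgt => /negP; apply.
  have le := sum_cost_le (inside K (F i) :\ p).
  rewrite (big_setD1 p) //= {1}/cost sp; have /andP[pt _] := sp.
  have : tau * (1 + #|inside K (F i) :\ p|) <= tau * b i.
    by rewrite leq_mul2l; apply/orP; right; move: Kb; rewrite (cardsD1 p (inside K _)) pI.
  apply: leq_trans; rewrite mulnDr muln1 mulnC -addSn leq_add ?(mulnC _ tau) //.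
    by rewrite (leq_trans pt) // (leq_trans _ t_tau) // leq_pmull.
  by rewrite mulnC.
(* Tightness now forces [b i] big pieces inside [F i]; only [#|D|] of them are taken, which leaves
   room for [E]. *)
have [f [finj fG]] : exists f : T -> {set T}, {in E &, injective f} /\
    {in E, forall u, f u \in inside K (F i) :\: L}.
  apply: (card_injection set0).
  have [->|[u uE]] := set_0Vmem E; first by rewrite cards0.
  have cK : b i <= #|inside K (F i)|.
    move: (tight u uE); rewrite (sum_cost_big (ns u uE)) mulnC leq_pmul2r //.
    by rewrite (leq_trans _ t_tau) // muln_gt0.
  rewrite cardsD; have -> : inside K (F i) :&: L = inside L (F i).
    apply/setP => p; rewrite !inE; apply/andP/andP => -[] //.
      by case/andP.
    by move=> pL pF; rewrite pF (subsetP LK).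
  have le := leq_trans DE cK.
  by rewrite cLD leq_subRL // (leq_trans _ le) // leq_addr.
have EA u : u \in E -> u \notin assigned q.
  rewrite !inE => /andP[/andP[/negPf uV _] /eqP ->].
  by rewrite uV (negPf iq) andbF.
have EAq u : u \in assigned (rcons q i) -> (u \in E) || (u \in assigned q).
  rewrite !inE mem_rcons inE => /andP[->]; rewrite !andbT /=.
  by case: (u \in V') => //=; case: eqP.
exists K, (fun u => if u \in E then f u else A u); split.
- split=> // j; rewrite mem_rcons inE => /orP[/eqP->|/J5] //.
  apply: leq_trans Kb; apply/subset_leq_card/subsetP => p; rewrite !inE => /andP[pK].
  by rewrite pK; case: (JF p pK) => // ->.
- move=> X Xq; have Xq' : {in q, forall j, F j \subset X \/ [disjoint F j & X]}.
    by move=> j jq; apply: Xq; rewrite mem_rcons inE jq orbT.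
  have d0 (Y : {set T}) : [disjoint Y :\: F i & F i].
    by rewrite -setI_eq0 setDE -setIA (setIC (~: _)) setICr setI0.
  have iqi : i \in rcons q i by rewrite mem_rcons mem_head.
  have [iX|d] := Xq i iqi; last by apply: covd; rewrite // disjoint_sym.
  have -> : inside K X = inside K (F i) :|: inside K (X :\: F i).
    apply/setP => p; rewrite !inE subsetD -andb_orr; case pK: (p \in K) => //=.
    case: (JF p pK) => h; last by rewrite h andbT orb_idl // => /subset_trans; apply.
    by rewrite h (subset_trans h).
  rewrite (eq_bigl (mem [predU inside K (F i) & inside K (X :\: F i)])); last first.
    by move=> p; rewrite in_setU.
  rewrite bigU /=; last first.
    rewrite -setI_eq0; apply/eqP/setP => p; rewrite !inE; apply/negP.
    case/andP=> /andP[pK pF] /andP[_ pX].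
    by move: (noinside K p _ J2 pK pX (d0 X)); rewrite pF.
  have -> : V' :&: X = (V' :&: F i) :|: (V' :&: (X :\: F i)).
    by rewrite -setIUr setDE setUIr setUCr setIT (setUidPr iX).
  rewrite (leq_trans (leq_card_setU _ _)) // leq_add //; apply: covd.
    move=> j jq; have [d|s] := nested_smaller Fnested (qi j jq).
      by case: (Xq' j jq) => h; [left; rewrite subsetD h | right; apply: disjointWr h; apply: subsetDl].
    by right; apply: disjointWl s _; rewrite disjoint_sym.
  exact: d0.
- split.
  + move=> u uD; case: ifP => uE; first by have := fG u uE; rewrite !inE => /andP[_ /andP[]].
    by apply: (subsetP LK); apply: imset_f; move: (EAq u uD); rewrite uE.
  + move=> u v uD vD /=; case: ifP => uE; case: ifP => vE.
    * exact: finj.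
    * move=> fA; have := fG u uE; rewrite inE fA => /andP[/negP[]].
      by apply: imset_f; move: (EAq v vD); rewrite vE.
    * move=> fA; have := fG v vE; rewrite inE -fA => /andP[/negP[]].
      by apply: imset_f; move: (EAq u uD); rewrite uE.
    by apply: A2; [move: (EAq u uD); rewrite uE | move: (EAq v vD); rewrite vE].
  + move=> u uO; have uE : (u \in E) = false by move: uO; rewrite !inE => /andP[_ ->].
    by rewrite uE A3.
  move=> u /setDP[uD uV]; case: ifP => uE; last by apply: A4; rewrite inE uV; move: (EAq u uD); rewrite uE.
  have ub : beta u = i by move: uE; rewrite inE => /andP[_ /eqP].
  have /setDP[/[!inE] /andP[gK gF] gL] := fG u uE.
  (* A piece meeting [O] would be a singleton of [O :&: V'], already owned by its own element and
     hence in [L]. *)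
  have gO : [disjoint f u & O].
    case: (J4 _ gK) => [[x gx]|[//]]; rewrite gx disjoints1.
    apply: contraNN gL => xO; apply/imsetP; exists x.
      by rewrite inE xO -sub1set -gx J3.
    by rewrite A3 // inE xO -sub1set -gx J3.
  split=> //; first by rewrite ub.
  have := ns u uE (f u); rewrite inE gK gF => /(_ isT).
  by rewrite negb_and gO orbF -leqNgt.
Qed.

(** Once all indices are processed every element of [O] owns a piece. The last clause is what makes
    every choice of representatives independent. *)
Lemma laminar_clusters : exists A : T -> {set T},
  [/\ {in O :\: V', forall u, [/\ A u \subset V' :\: O, A u \subset F (beta u) & t <= #|A u|]},
      {in O :\: V' &, forall u v, u != v -> [disjoint A u & A v]},
      {in O :&: V', forall u, A u = [set u]} &
      forall i, #|[set u in O | ~~ [disjoint A u & F i]]| <= b i].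
Proof.
pose r := sort (fun i j => #|F i| <= #|F j|) (enum I).
have rI i : i \in r by rewrite mem_sort mem_enum.
have ur : uniq r by rewrite sort_uniq enum_uniq.
have : pairwise (fun i j => #|F i| <= #|F j|) r.
  rewrite -sorted_pairwise; last by move=> j i k; apply: leq_trans.
  by apply: sort_sorted => i j /=; exact: leq_total.
suff H q : uniq q -> pairwise (fun i j => #|F i| <= #|F j|) q -> stage q.
  move=> /(H _ ur)[K [A [[K1 _ K3 K4 K5] _ [A1 A2 A3 A4]]]].
  have D u : (u \in assigned r) = (u \in O) by rewrite inE rI orbT andbT.
  exists A; split=> //.
  - move=> u; rewrite inE => /andP[uV uO].
    have [|? d ?] := A4 u; first by rewrite inE uV D.
    by split=> //; rewrite subsetD d K3 // A1 // D.
  - move=> u v /setDP[uO _] /setDP[vO _] uv; apply: K1; rewrite ?A1 ?D //.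
    by apply: contraNneq uv => /A2 ->; rewrite ?D.
  move=> i; apply: leq_trans (K5 i (rI i)).
  rewrite -(card_in_imset (f := A)); last first.
    by move=> u v; rewrite !inE => /andP[uO _] /andP[vO _]; apply: A2; rewrite D.
  apply/subset_leq_card/subsetP => _ /imsetP[u uO ->]; move: uO.
  by rewrite !inE => /andP[uO ->]; rewrite A1 // D.
elim/last_ind: q => [|q i IH]; first by move=> _ _; apply: stage0.
rewrite rcons_uniq pairwise_rcons => /andP[iq uq] /andP[/allP qi pq].
by apply: stage_rcons => //; apply: IH.
Qed.

End Clusters.

(** * Transversal matroids *)

Section Transversal.
Variables (T : finType) (m : nat) (F : 'I_m -> {set T}).
Implicit Types (S : {set T}) (psi : T -> 'I_m).

(** For [c = 1] this is a matching of [S] into the indices, for [c = tau] a certificate of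
    independence in the union. Values of [psi] outside [S] are irrelevant. *)
Definition assigns c S psi := {in S, forall x, x \in F (psi x)} /\
  forall j, #|[set x in S | psi x == j]| <= c.

Lemma card_preim_sum S psi (J : {set 'I_m}) :
  #|[set x in S | psi x \in J]| = \sum_(j in J) #|[set x in S | psi x == j]|.
Proof.
rewrite -sum1_card (partition_big psi (mem J)) /=; last by move=> x; rewrite inE => /andP[].
apply: eq_bigr => j jJ; rewrite -sum1_card; apply: eq_bigl => x; rewrite !inE.
by case: eqP => [->|]; rewrite ?andbF // jJ andbT.
Qed.

(** An arc from [j] to [j'] is an element assigned to [j] that could move to [j']. Inserting [u] at
    [j] evicts such an element, which is then inserted along the rest of the path, until an index
    with a free slot is reached. *)
Lemma augmenting_path c p S u psi j :
  assigns c S psi -> u \notin S -> u \in F j ->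
  path (fun j j' => [exists x in S, (psi x == j) && (x \in F j')]) j p ->
  uniq (j :: p) -> #|[set x in S | psi x == last j p]| < c ->
  exists psi', assigns c (u |: S) psi'.
Proof.
elim: p => [|j1 p IH] in S u psi j * => -[psiF psic] uS uj.
  move=> _ _ lt; exists (fun x => if x == u then j else psi x); split.
    by move=> x /[!inE] /orP[/eqP->|xS]; [rewrite eqxx | case: eqP => [->|_ ]//; apply: psiF].
  move=> j'; have [->|jj'] := eqVneq j' j.
    apply: leq_trans lt; rewrite -add1n /=.
    apply: leq_trans (_ : #|u |: [set x in S | psi x == j]| <= _).
      apply/subset_leq_card/subsetP => x; rewrite !inE.
      by case: (x == u).
    by rewrite cardsU1 leq_add2r leq_b1.
  apply: leq_trans (psic j'); apply/subset_leq_card/subsetP => x; rewrite !inE.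
  by case: (x == u) => //; rewrite eq_sym (negPf jj').
rewrite /= => /andP[/existsP[x /and3P[xS /eqP psix xj1]] pp] /andP[jp up] lt.
have xu : x != u by apply: contraNneq uS => <-.
(* After the first exchange [x] plays the role of [u]; only the fiber of [j] changes its
   elements. *)
pose S1 := u |: (S :\ x); pose psi1 y := if y == u then j else psi y.
have psi1E y : y \in S -> psi1 y = psi y.
  by rewrite /psi1; case: eqP => // -> uS'; rewrite uS' in uS.
have fib j' : j' != j -> [set y in S1 | psi1 y == j'] = [set y in S | psi y == j'].
  move=> jj'; apply/setP => y; rewrite !inE /psi1; case: (eqVneq y u) => [->|yu] /=.
    by rewrite eq_sym (negPf jj') (negPf uS).
  case: (eqVneq y x) => [->|_]; last by rewrite andTb.
  by rewrite psix eq_sym (negPf jj') !andbF.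
have -> : u |: S = x |: S1.
  by apply/setP => y; rewrite !inE; case: (eqVneq y x) => [->|]; rewrite ?xS ?orbT.
apply: (IH S1 x psi1 j1); rewrite ?inE ?eqxx ?(negPf xu) //.
- split=> [y|j'].
    rewrite !inE => /orP[/eqP->|/andP[_ yS]]; first by rewrite /psi1 eqxx.
    by rewrite psi1E // psiF.
  have [->|jj'] := eqVneq j' j; last by rewrite fib.
  apply: leq_trans (psic j); rewrite (cardsD1 x [set y in S | _]) !inE xS psix eqxx /=.
  apply: leq_trans (_ : #|u |: ([set y in S | psi y == j] :\ x)| <= _).
    apply/subset_leq_card/subsetP => y; rewrite !inE /psi1.
    by case: (y == u); case: (y == x).
  by rewrite cardsU1 leq_add2r leq_b1.
(* The path does not return to [j], so its remaining arcs are witnessed by elements other than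
   [x]. *)
- apply: (sub_in_path (P := predC1 j)) pp.
    move=> a a' aj _ /existsP[y /and3P[yS /eqP ya ya']]; apply/existsP; exists y.
    rewrite psi1E // ya eqxx ya' !andbT !inE yS andbT orbC.
    by apply/orP; left; move: aj; apply: contraNneq => yx; rewrite -ya yx psix /=.
  by apply/allP => a ap; apply: contraNneq jp => <-.
- rewrite fib //; apply: contraNneq jp => <-; exact: mem_last.
Qed.

(** Take for [J] the indices reachable from those available to [u]: each is full, as otherwise a
    path would augment, and an element assigned into [J] has no alternative outside [J]. *)
Lemma unaugmentable_tight c S u psi : assigns c S psi -> u \notin S ->
  ~ (exists psi', assigns c (u |: S) psi') ->
  exists J : {set 'I_m}, (forall j, u \in F j -> j \in J) /\
    c * #|J| <= #|[set x in S | [forall j, (x \in F j) ==> (j \in J)]]|.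
Proof.
move=> apsi uS naug.
pose e j j' := [exists x in S, (psi x == j) && (x \in F j')].
pose J := [set j' | [exists j, (u \in F j) && connect e j j']].
have JP j' : reflect (exists2 j, u \in F j & connect e j j') (j' \in J).
  by rewrite inE; apply: (iffP existsP) => -[j] => [/andP[]|]; exists j => //; apply/andP.
exists J; split=> [j uj|]; first by apply/JP; exists j.
have full j : j \in J -> c <= #|[set x in S | psi x == j]|.
  case/JP=> j0 uj0 /connectP[p0 ep0 ->]; case/shortenP: ep0 => p ep up _.
  rewrite leqNgt; apply/negP => lt; apply: naug.
  exact: augmenting_path apsi uS uj0 ep up lt.
apply: (@leq_trans #|[set x in S | psi x \in J]|).
  by rewrite card_preim_sum mulnC -sum_nat_const; apply: leq_sum.
apply/subset_leq_card/subsetP => x; rewrite inE => /andP[xS /JP[j0 uj0 j0x]].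
rewrite inE xS; apply/forallP => j; apply/implyP => xj; apply/JP; exists j0 => //.
apply: connect_trans j0x (connect1 _).
by apply/existsP; exists x; rewrite xS eqxx.
Qed.

(* A tight set of indices is filled by the same elements under every assignment. *)
Lemma tight_fiber c S V psi (J : {set 'I_m}) : assigns c V psi -> S \subset V ->
  c * #|J| <= #|[set x in S | [forall j, (x \in F j) ==> (j \in J)]]| ->
  forall j, j \in J -> c <= #|[set x in V | psi x == j]| /\
    {in V, forall x, psi x = j -> x \in S}.
Proof.
move=> [psiF psic] SV; set X := [set x in S | _] => le j jJ.
pose Y := [set x in V | psi x \in J].
have XY : X \subset Y.
  apply/subsetP => x; rewrite !inE => /andP[/(subsetP SV) xV /forallP/(_ (psi x))].
  by rewrite psiF // xV.
(* Isolating the fiber of [j] forces it to be full, as the other fibers over [J] hold at most [c]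
   elements each. *)
have Yle : #|Y| <= #|[set x in V | psi x == j]| + c * #|J :\ j|.
  rewrite card_preim_sum (big_setD1 j) //= leq_add2l mulnC -sum_nat_const.
  exact: leq_sum.
have XY' := leq_trans le (subset_leq_card XY).
have cj : c <= #|[set x in V | psi x == j]|.
  rewrite -(leq_add2r (c * #|J :\ j|)); apply: leq_trans Yle; apply: leq_trans XY'.
  by rewrite (cardsD1 j J) jJ mulnDr muln1.
split=> // x xV psix; have /eqP XE : X == Y.
  rewrite eqEcard XY (leq_trans _ le) // card_preim_sum mulnC -sum_nat_const.
  exact: leq_sum.
have : x \in Y by rewrite inE xV psix.
by rewrite -XE inE => /andP[].
Qed.

Variable M : matroid T.
Hypothesis HM : forall S, indep M S <-> exists phi : {u : T | u \in S} -> 'I_m,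
  injective phi /\ forall u, val u \in F (phi u).
Variable j0 : 'I_m.

Lemma transversal_indep S : indep M S <-> exists psi, assigns 1 S psi.
Proof.
split=> [/HM[phi [phi_inj phiF]]|[psi [psiF psi1]]].
  pose psi x := if insub x is Some u then phi u else j0.
  have psiE x (xS : x \in S) : psi x = phi (exist _ x xS).
    by rewrite /psi insubT.
  exists psi; split=> [x xS|j]; first by rewrite psiE (phiF (exist _ x xS)).
  apply/card_le1_eqP => x y; rewrite !inE => /andP[xS /eqP xj] /andP[yS /eqP yj].
  by move: yj; rewrite -xj !psiE => /phi_inj [].
apply/HM; exists (fun u => psi (val u)); split=> [u v uv|u]; last by apply/psiF/(valP u).
apply: val_inj; apply: (card_le1_eqP (psi1 (psi (val v)))).
  by rewrite inE eqxx (valP v).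
by rewrite inE [psi _]uv eqxx (valP u).
Qed.

Lemma transversal_union_indep tau S : 0 < tau ->
  union_indep M tau S <-> exists psi, assigns tau S psi.
Proof.
move=> tau0; split.
  case/existsP=> P /and3P[/eqP -> _ /forallP iP].
  have /fin_all_exists[psi_ psiP] : forall c, exists psi, assigns 1 (P c) psi.
    by move=> c; apply/transversal_indep.
  pose psi x := if [pick c | x \in P c] is Some c then psi_ c x else j0.
  have psiE x : x \in \bigcup_(c < tau) P c -> exists2 c, x \in P c & psi x = psi_ c x.
    case/bigcupP=> c _ xc; rewrite /psi; case: pickP => [d xd|/(_ c)].
      by exists d.
    by rewrite xc.
  exists psi; split=> [x /psiE[c xc ->]|j]; first exact: (psiP c).1.
  apply: (@leq_trans #|\bigcup_(c < tau) [set x in P c | psi_ c x == j]|).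
    apply/subset_leq_card/subsetP => x; rewrite inE => /andP[/psiE[c xc ->] /eqP xj].
    by apply/bigcupP; exists c; rewrite // inE xc xj /=.
  apply: (@leq_trans (\sum_(c < tau) 1)); last by rewrite sum1_card card_ord.
  elim/big_rec2: _ => [|c n A _ IH]; first by rewrite cards0.
  by rewrite (leq_trans (leq_card_setU _ _)) // leq_add // (psiP c).2.
(* The fibers are disjoint, hence nested; an equitable colouring with all bounds equal to 1 makes
   each colour class meet each fiber at most once. *)
case=> psi [psiF psic]; pose B j := [set x in S | psi x == j].
have Bn i j : nested (B i) (B j).
  have [->|ij] := eqVneq i j; first by rewrite /nested subxx !orbT.
  apply/orP; left; rewrite -setI_eq0; apply/eqP/setP => x; rewrite !inE.
  by apply/negP => /andP[/andP[_ /eqP Ei] /andP[_ /eqP Ej]]; rewrite -Ei Ej eqxx in ij.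
have SB j : #|S :&: B j| <= tau * 1.
  by rewrite muln1 (leq_trans _ (psic j)) // subset_leq_card // subsetIr.
have [P [SP Pd Pb]] := nested_equitable_coloring Bn tau0 SB.
apply/existsP; exists P; apply/and3P; split; first by rewrite {1}SP.
  by apply/forallP=> c; apply/forallP=> d; apply/implyP; apply: Pd.
apply/forallP => c; apply/transversal_indep; exists psi.
have PS x : x \in P c -> x \in S by move=> xc; rewrite SP; apply/bigcupP; exists c.
split=> [x /PS|j]; first exact: psiF.
apply: leq_trans (Pb c j); apply/subset_leq_card/subsetP => x.
by rewrite !inE => /andP[xc ->]; rewrite xc PS.
Qed.

End Transversal.

Lemma transversal_robust (R : realFieldType) (T : finType) (M : matroid T)
    (w : T -> R) (t tau : nat) (s : seq T) :
  0 < tau -> nonincreasing_order w s -> transversal_matroid M ->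
  t + rank M - 1 <= tau -> robust M w t (greedy (union_indep M tau) s).
Proof.
move=> tau0 hs [m [F HM]] le; apply: robust_of_exchange => O u0 bO u0O.
set V' := greedy _ s.
have [phi0 _] := (HM O).1 (base_indep bO).
have j0 : 'I_m by apply: phi0; exists u0; case/setDP: u0O.
have iP S := transversal_indep HM j0 S.
have uP S := transversal_union_indep HM j0 S tau0.
have [phi [phiF phi1]] := (iP O).1 (base_indep bO).
have [psi psiV] := (uP V').1 (greedy_union_feasible M tau s).
(* The tight set comes from the moment of rejection, but [tight_fiber] transfers it to the final
   assignment [psi] of [V']. *)
have fiber u : u \in O :\: V' -> tau <= #|[set x in V' | psi x == phi u]| /\
    {in V', forall x, psi x = phi u -> (w u <= w x)%R}.
  move=> /setDP[uO uV].
  have [S [/uP[psiS aS] SV nS Sw]] := greedy_union_rejected hs uV.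
  have uS : u \notin S by apply: contra uV; apply: (subsetP SV).
  have [|J [JF Jle]] := unaugmentable_tight aS uS _; first by move/uP; apply/negP.
  have [cj jS] := tight_fiber psiV SV Jle (JF _ (phiF u uO)).
  by split=> // x xV xj; apply/Sw/jS.
have phi_inj : {in O &, injective phi}.
  move=> u v uO vO uv; apply: (card_le1_eqP (phi1 (phi v))); by rewrite !inE ?uO ?vO ?uv eqxx.
exists (fun u => [set x in V' | psi x == phi u] :\: O); split.
- by move=> u _; apply: setSD; apply/subsetP => x; rewrite inE => /andP[].
- move=> u v /setDP[uO _] /setDP[vO _] uv; rewrite -setI_eq0; apply/eqP/setP => x.
  rewrite !inE; apply/negP => /andP[/and3P[_ _ /eqP xu] /and3P[_ _ /eqP xv]].
  by case/eqP: uv; apply: phi_inj; rewrite // -xu.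
- move=> u uD; have [tle _] := fiber u uD; have /setDP[uO uV] := uD.
  rewrite cardsD; set B := [set x in V' | _].
  (* Strict because [u] belongs to [O] but not to [V']; this is the [- 1] in the bound on [tau]. *)
  have : #|B :&: O| < rank M.
    rewrite -(base_card bO); apply: proper_card; apply/properP; split; first exact: subsetIr.
    by exists u; rewrite // !inE (negPf uV).
  move: tle; rewrite -/B; lia.
- by move=> u uD x; rewrite !inE => /and3P[_ xV /eqP xj]; apply: (fiber u uD).2.
(* Each replacement [g u] inherits the index [phi u], so the new matching uses only indices of the
   old one. *)
move=> g gid gA; apply/iP; exists (fun x => if x \in O then phi x else psi x).
have gP u : u \in O -> (if g u \in O then phi (g u) else psi (g u)) = phi u /\ g u \in F (phi u).
  move=> uO; have [uV|uV] := boolP (u \in V').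
    by rewrite gid ?inE ?uO // phiF.
  have := gA u; rewrite !inE uV uO => /(_ isT) /and3P[/negPf -> gV /eqP <-].
  by split=> //; apply: psiV.1.
split=> [_ /imsetP[u uO ->]|j]; first by have [-> ] := gP u uO.
apply: leq_trans (phi1 j); apply: leq_trans (leq_imset_card g _).
apply/subset_leq_card/subsetP => x; rewrite inE => /andP[/imsetP[u uO ->]].
by have [-> _] := gP u uO => uj; apply: imset_f; rewrite inE uO.
Qed.

(** * Robustness for laminar and partition matroids *)

Section Robust.
Variables (R : realFieldType) (T : finType) (M : matroid T) (w : T -> R).
Variables (t tau : nat) (s : seq T).
Hypotheses (t_gt0 : 0 < t) (hs : nonincreasing_order w s).

Let V' := greedy (union_indep M tau) s.

Lemma laminar_robust : laminar_matroid M -> 2 * t <= tau -> robust M w t V'.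
Proof.
case=> r [F [b [Fl HM]]] le.
have tau0 : 0 < tau by rewrite (leq_trans _ le) // muln_gt0.
apply: robust_of_exchange => O u0 bO u0O.
(* The option type covers elements outside [O :\: V'] while no index is known to exist; [u0] then
   yields a default [i0]. *)
have /fin_all_exists[beta betaP] : forall u : T, exists i : option 'I_r,
    u \in O :\: V' -> if i is Some i then [/\ u \in F i, tau * b i <= #|V' :&: F i| &
      {in V' :&: F i, forall x, (w u <= w x)%R}] else False.
  move=> u; have [/setDP[uO uV]|] := boolP (u \in O :\: V'); last by exists None.
  have [i iP] := greedy_nested_tight tau0 hs Fl HM uV.
  by exists (Some i).
have [i0 _] : exists i : 'I_r, True.
  by move: (betaP u0 u0O); case: (beta u0) => // i _; exists i.
pose beta' u := odflt i0 (beta u).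
have {}betaP u : u \in O :\: V' -> [/\ u \in F (beta' u),
    tau * b (beta' u) <= #|V' :&: F (beta' u)| &
    {in V' :&: F (beta' u), forall x, (w u <= w x)%R}].
  by move=> /betaP; rewrite /beta'; case: (beta u).
have [||||A [A1 A2 A3 A4]] := @laminar_clusters _ _ F b t tau V' O beta' Fl t_gt0 le _ _ _ _.
- by move=> i; apply: (HM O).1 (base_indep bO) i.
- exact: greedy_nested_card.
- by move=> u /betaP[].
- by move=> u /betaP[].
exists A; split=> // [u /A1[]|u /A1[]|u uD x xA|g gid gA] //.
  have [/subsetP AV /subsetP AF _] := A1 u uD; have [_ _] := betaP u uD; apply.
  by rewrite inE AF // andbT; move: (AV x xA); rewrite inE => /andP[].
apply/HM => i; apply: leq_trans (A4 i); apply: leq_trans (leq_imset_card g _).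
apply/subset_leq_card/subsetP => x; rewrite inE => /andP[/imsetP[u uO ->] gF].
apply: imset_f; rewrite inE uO; apply/negP => d.
have gAu : g u \in A u.
  have [uV|uV] := boolP (u \in V'); last by apply: gA; rewrite inE uV.
  by rewrite A3 ?inE ?uO // gid ?inE ?uO ?eqxx.
by rewrite (disjointFr d gAu) in gF.
Qed.

Lemma partition_robust : partition_matroid M -> t <= tau -> robust M w t V'.
Proof.
case=> P [b [/and3P[/eqP cP tP _] HM]] le.
have tau0 : 0 < tau by apply: leq_trans le.
apply: robust_of_exchange => O _ bO _.
(* Indexing the blocks by the elements they contain turns the partition into a nested family over a
   finite type. *)
pose F x := pblock P x.
have Fin x : x \in F x by rewrite mem_pblock cP inE.
have FP x : F x \in P by rewrite pblock_mem // cP inE.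
have Fd x y : F x != F y -> [disjoint F x & F y].
  by move/trivIsetP: tP; apply.
have Fn x y : nested (F x) (F y).
  by have [->|/Fd d] := eqVneq (F x) (F y); rewrite /nested ?subxx ?d ?orbT.
have HM' A : indep M A <-> forall x, #|A :&: F x| <= b (F x).
  split=> [/HM h x|h]; first exact: h.
  apply/HM => B BP; have [->|[x xB]] := set_0Vmem B; first by rewrite setI0 cards0.
  by rewrite -(def_pblock tP BP xB).
have Vle x := greedy_nested_card s tau0 Fn HM' x.
have tight u : u \in O :\: V' -> tau * b (F u) <= #|V' :&: F u| /\
    {in V' :&: F u, forall x, (w u <= w x)%R}.
  move=> /setDP[uO uV]; have [x [ux xV xw]] := greedy_nested_tight tau0 hs Fn HM' uV.
  by rewrite [F u](_ : _ = F x) //; apply: def_pblock.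
have [||A [A1 A2 A3]] := @disjoint_blocks T _ (O :\: V') F (fun B => V' :&: B :\: O) t t_gt0.
- move=> u v _ _ /Fd d; apply: disjointW d; apply: subset_trans (subsetDl _ _) (subsetIr _ _).
- move=> u uD; have [le1 _] := tight u uD.
  have OF : #|O :&: F u| <= b (F u) by apply: (HM' O).1 (base_indep bO) u.
  set E := [set v in _ | _].
  (* Multiplied by [tau], this leaves [t * #|E|] elements of the full block outside [O], as [tau] is
     at least [t] and at least 1. *)
  have : #|E| + #|V' :&: F u :&: O| <= #|O :&: F u|.
    rewrite -cardsUI (_ : E :&: _ = set0) ?cards0 ?addn0; last first.
      apply/setP => x; rewrite !inE; apply/negP => /andP[/andP[/andP[/negPf xV _] _]].
      by rewrite xV.
    apply/subset_leq_card/subsetP => x; rewrite !inE => /orP[|].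
      by case/andP=> /andP[_ ->] /eqP <- /=.
    by case/andP=> /andP[_ ->] ->.
  rewrite cardsD; nia.
exists A; split=> // [u uD|u uD x xA|g gid gA].
- by apply: subset_trans (A1 u uD) _; apply: setSD; apply: subsetIl.
- apply: (tight u uD).2; move: (subsetP (A1 u uD) x xA).
  by rewrite inE => /andP[].
apply/HM' => x; apply: (@leq_trans #|O :&: F x|); last exact: (HM' O).1 (base_indep bO) x.
(* Each element is replaced within its own block, so a block meets [g @: O] in no more elements than
   it meets [O]. *)
apply: leq_trans (leq_imset_card g _).
apply/subset_leq_card/subsetP => y; rewrite inE => /andP[/imsetP[u uO ->] gF].
apply: imset_f; rewrite inE uO /=.
have [uV|uV] := boolP (u \in V'); first by rewrite gid ?inE ?uO in gF.
have uD : u \in O :\: V' by rewrite inE uV.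
move: (subsetP (A1 u uD) _ (gA u uD)); rewrite inE => /andP[_ /setIP[_ gu]].
apply: contraTT (Fin u) => ux.
have /Fd d : F u != F x by apply: contraNneq ux => <-.
by move: gu; rewrite (disjointFl d gF).
Qed.

End Robust.

Theorem theorem4 (R : realFieldType) (T : finType) (M : matroid T) (k : nat)
    (hk : rank M = k) (w : T -> R) (w_ge0 : forall u, (0 <= w u)%R)
    (t tau : nat) (t_gt0 : 0 < t) (tau_gt0 : 0 < tau)
    (s : seq T) (hs : nonincreasing_order w s) :
  [/\ partition_matroid M -> t <= tau ->
        robust M w t (greedy (union_indep M tau) s),
      laminar_matroid M -> 2 * t <= tau ->
        robust M w t (greedy (union_indep M tau) s) &
      transversal_matroid M -> t + k - 1 <= tau ->
        robust M w t (greedy (union_indep M tau) s)].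
Proof.
split; first exact: partition_robust.
  exact: laminar_robust.
by rewrite -hk; apply: transversal_robust.
Qed.
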